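(* Let $A$ and $L$ be two residuated lattices such that $L$ is Cauchy-complete, and let $s:A\rightarrow L$ be an order-preserving type I state. Let $\tilde{A}_s$, $\tilde{s}:\tilde{A}_s\rightarrow L$, $\tilde{\rho_s}:\tilde{A}_s\times\tilde{A}_s\rightarrow L$ and $\varphi_s:A\rightarrow\tilde{A}_s$ be as constructed in the context. Then: (1) $\tilde{A}_s$ is a residuated lattice; if $L$ is involutive then $\tilde{A}_s$ is also involutive; (2) $\tilde{s}$ is a faithful order-preserving type I state; (3) $\varphi_s$ is a residuated lattice morphism and $\tilde{s}\circ\varphi_s=s$; (4) $\varphi_s$ is injective iff $s$ is faithful; (5) $\tilde{\rho_s}=\rho_{\tilde{s}}$; (6) for any sequence $(a_n)_{n\geq 0}\subseteq A$ and any $a\in A$, if $(a_n)_{n\ge 0}$ is $\rho_s$-convergent towards $a$, then $(\varphi_s(a_n))_{n\geq 0}$ is $\tilde{\rho_s}$-convergent towards $\varphi_s(a)$; (7) for any residuated lattice $C$, any faithful order-preserving type I state $m:C\rightarrow L$ such that $C$ is $\rho_m$-complete, and any residuated lattice morphism $f:A\rightarrow C$ such that $m\circ f=s$, there exists a residuated lattice morphism $\tilde{f}:\tilde{A}_s\rightarrow C$ such that $m\circ\tilde{f}=\tilde{s}$ and $\tilde{f}\circ\varphi_s=f$.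
   Context: A residuated lattice is an algebra $(A,\vee,\wedge,\odot,\rightarrow,0,1)$ such that $(A,\vee,\wedge,0,1)$ is a bounded lattice, $(A,\odot,1)$ is a commutative monoid, and for all $a,b,c\in A$: $a\leq b\rightarrow c$ iff $a\odot b\leq c$. Write $\neg a=a\rightarrow 0$ and $d_A(a,b)=a\leftrightarrow b=(a\rightarrow b)\wedge(b\rightarrow a)$. $A$ is involutive iff $\neg\neg a=a$ for all $a\in A$. Morphisms preserve all operations and constants. For residuated lattices $A,L$, a function $s:A\rightarrow L$ is a type I state (generalized Bosbach state of type I) iff $s(0)=0$, $s(1)=1$ and $s(a\rightarrow b)=s(a)\rightarrow s(b)$ for all $a,b\in A$ with $b\leq a$. It is order-preserving iff $a\leq b$ implies $s(a)\leq s(b)$; it is faithful iff $s(a)=1$ implies $a=1$. For $s:A\rightarrow L$ put $\rho_s(a,b)=s(d_A(a,b))$ for $a,b\in A$. Convergence in $L$: $(c_n)\uparrow 1$ means that $(c_n)_{n\geq0}\subseteq L$ is increasing with supremum $1$. A sequence $(a_n)_{n\geq 0}\subseteq L$ converges towards $a\in L$ (written $\lim_{n\rightarrow\infty}a_n=a$) iff there is $(c_n)_{n\geq 0}\subseteq L$ with $(c_n)\uparrow 1$ and $c_n\leq d_L(a_n,a)$ for all $n$; such a limit is unique. A sequence $(a_n)\subseteq L$ is Cauchy iff there is $(c_n)\subseteq L$ with $(c_n)\uparrow 1$ and $c_n\leq d_L(a_n,a_{n+p})$ for all $n,p\in\mathbb{N}$. $L$ is Cauchy-complete iff every Cauchy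 sequence in $L$ is convergent. For a nonempty set $X$, an $L$-similarity relation on $X$ is a function $E:X^2\rightarrow L$ with $E(a,a)=1$, $E(a,b)=E(b,a)$, $E(a,b)\odot E(b,c)\leq E(a,c)$ for all $a,b,c\in X$; it is an $L$-equality iff moreover $E(a,b)=1$ implies $a=b$. A sequence $(a_n)\subseteq X$ is $E$-convergent towards $a\in X$ iff $\lim_{n\rightarrow\infty}E(a_n,a)=1$ in $L$; it is $E$-Cauchy iff there is $(c_n)\subseteq L$ with $(c_n)\uparrow1$ and $c_n\leq E(a_n,a_{n+p})$ for all $n,p\in\mathbb{N}$. $X$ is $E$-complete iff $E$ is an $L$-equality and every $E$-Cauchy sequence is $E$-convergent. If $s$ is an order-preserving type I state then $\rho_s$ is an $L$-similarity relation on $A$, and it is an $L$-equality if $s$ is faithful. Construction (for $L$ Cauchy-complete and $s:A\rightarrow L$ an order-preserving type I state): let $\mathcal{C}_s(A)$ be the set of $\rho_s$-Cauchy sequences in $A$, with operations $\vee,\wedge,\odot,\rightarrow$ defined termwise and constants $\underline{0}=(0)_{n\geq0}$, $\underline{1}=(1)_{n\geq0}$. For $\underline{a}=(a_n),\underline{b}=(b_n)\in\mathcal{C}_s(A)$ put $\underline{a}\sim\underline{b}$ iff $\lim_{n\rightarrow\infty}\rho_s(a_n,b_n)=1$; this is an equivalence relation compatible with the operations. $\tilde{A}_s=\mathcal{C}_s(A)/_{\sim}$ with the induced operations and constants; $\tilde{\underline{a}}$ denotes the class of $\underline{a}$. Define (these are well defined) $\tilde{\rho_s}(\tilde{\underline{a}},\tilde{\underline{b}})=\lim_{n\rightarrow\infty}\rho_s(a_n,b_n)$,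 $\tilde{s}(\tilde{\underline{a}})=\lim_{n\rightarrow\infty}s(a_n)$, and $\varphi_s(a)=$ the class of the constant sequence $(a)_{n\geq0}$ for $a\in A$. *)

(* Defs.v *)
From mathcomp Require Import all_boot.
From mathcomp Require Import boolp classical_sets.

Set Implicit Arguments.
Unset Strict Implicit.
Unset Printing Implicit Defensive.

Local Open Scope quotient_scope.

Declare Scope rl_scope.
Delimit Scope rl_scope with RL.
Local Open Scope rl_scope.

(* Algebras are raw signatures, separate from their axioms, so that being a
   residuated lattice is a property which can be asserted of the completion. *)
Record rl_algebra := RLAlgebra {
  carrier :> Type;
  rjoin : carrier -> carrier -> carrier;
  rmeet : carrier -> carrier -> carrier;
  rmul : carrier -> carrier -> carrier;
  rimp : carrier -> carrier -> carrier;
  rbot : carrier;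
  rtop : carrier
}.

Arguments rbot {_}.
Arguments rtop {_}.

Notation "a ⊔ b" := (rjoin a b) (at level 50, left associativity) : rl_scope.
Notation "a ⊓ b" := (rmeet a b) (at level 50, left associativity) : rl_scope.
Notation "a ⊙ b" := (rmul a b) (at level 40, left associativity) : rl_scope.
Notation "a ⇒ b" := (rimp a b) (at level 55, right associativity) : rl_scope.

Definition rle (A : rl_algebra) (a b : A) : Prop := a ⊓ b = a.

Notation "a ≼ b" := (rle a b) (at level 70) : rl_scope.

Record is_residuated_lattice (A : rl_algebra) : Prop := IsResiduatedLattice {
  rjoinA : associative (@rjoin A);
  rjoinC : commutative (@rjoin A);
  rmeetA : associative (@rmeet A);
  rmeetC : commutative (@rmeet A);
  rmeetKU : forall a b : A, a ⊔ (a ⊓ b) = a;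
  rjoinKI : forall a b : A, a ⊓ (a ⊔ b) = a;
  rjoin0x : left_id (@rbot A) (@rjoin A);
  rmeet1x : left_id (@rtop A) (@rmeet A);
  rmulA : associative (@rmul A);
  rmulC : commutative (@rmul A);
  rmul1x : left_id (@rtop A) (@rmul A);
  rresid : forall a b c : A, a ≼ (b ⇒ c) <-> (a ⊙ b) ≼ c
}.

Record residuatedLattice := ResiduatedLattice {
  rl_alg :> rl_algebra;
  rl_axioms : is_residuated_lattice rl_alg
}.

Definition rneg (A : rl_algebra) (a : A) : A := a ⇒ rbot.

Definition rl_involutive (A : rl_algebra) : Prop := involutive (@rneg A).

Definition rdist (A : rl_algebra) (a b : A) : A := (a ⇒ b) ⊓ (b ⇒ a).

Definition rl_morphism (A B : rl_algebra) (f : A -> B) : Prop :=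
  [/\ forall a b, f (a ⊔ b) = f a ⊔ f b,
      forall a b, f (a ⊓ b) = f a ⊓ f b,
      forall a b, f (a ⊙ b) = f a ⊙ f b,
      forall a b, f (a ⇒ b) = f a ⇒ f b
    & f rbot = rbot /\ f rtop = rtop].

Definition typeI_state (A L : rl_algebra) (s : A -> L) : Prop :=
  [/\ s rbot = rbot, s rtop = rtop
    & forall a b : A, b ≼ a -> s (a ⇒ b) = s a ⇒ s b].

Definition order_preserving (A L : rl_algebra) (s : A -> L) : Prop :=
  forall a b : A, a ≼ b -> s a ≼ s b.

Definition faithful (A L : rl_algebra) (s : A -> L) : Prop :=
  forall a : A, s a = rtop -> a = rtop.

Definition rho (A L : rl_algebra) (s : A -> L) (a b : A) : L := s (rdist a b).

Definition is_sup (L : rl_algebra) (c : nat -> L) (x : L) : Prop :=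
  (forall n, c n ≼ x) /\ (forall y, (forall n, c n ≼ y) -> x ≼ y).

Definition increases_to_top (L : rl_algebra) (c : nat -> L) : Prop :=
  (forall m n, m <= n -> c m ≼ c n) /\ is_sup c rtop.

Definition converges (L : rl_algebra) (u : nat -> L) (l : L) : Prop :=
  exists2 c : nat -> L, increases_to_top c & forall n, c n ≼ rdist (u n) l.

(* The limit of [u]; the value [rtop] is used for divergent sequences. *)
Definition rlim (L : rl_algebra) (u : nat -> L) : L :=
  xget (rtop : {classic L}) [set l | converges u l].

Section Similarity.
Variables (X : Type) (L : rl_algebra) (E : X -> X -> L).

Definition similarity : Prop :=
  [/\ forall a, E a a = rtop, forall a b, E a b = E b a
    & forall a b c, (E a b ⊙ E b c) ≼ E a c].

Definition L_equality : Prop :=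
  similarity /\ (forall a b, E a b = rtop -> a = b).

Definition E_converges (u : nat -> X) (a : X) : Prop :=
  converges (fun n => E (u n) a) rtop.

Definition E_cauchy (u : nat -> X) : Prop :=
  exists2 c : nat -> L, increases_to_top c &
    forall n p : nat, c n ≼ E (u n) (u (n + p)).

Definition E_complete : Prop :=
  L_equality /\ (forall u, E_cauchy u -> exists a, E_converges u a).

End Similarity.

Definition cauchy_complete (L : rl_algebra) : Prop :=
  forall u : nat -> L, E_cauchy (@rdist L) u -> exists l, converges u l.

Section ResiduatedLatticeTheory.
Variable A : residuatedLattice.
Implicit Types a b c x y z : A.

Let ax := rl_axioms A.

Lemma rle_refl a : a ≼ a.
Proof. by rewrite /rle -{2}(rmeetKU ax a a) (rjoinKI ax). Qed.

Lemma rle_trans b a c : a ≼ b -> b ≼ c -> a ≼ c.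
Proof. by rewrite /rle => ab bc; rewrite -ab -(rmeetA ax) bc. Qed.

Lemma rle_anti a b : a ≼ b -> b ≼ a -> a = b.
Proof. by rewrite /rle => ab ba; rewrite -ab (rmeetC ax) ba. Qed.

Lemma rle_meetl a b : (a ⊓ b) ≼ a.
Proof. by rewrite /rle (rmeetC ax a) -(rmeetA ax) (rle_refl _). Qed.

Lemma rle_meetr a b : (a ⊓ b) ≼ b.
Proof. by rewrite /rle -(rmeetA ax) (rle_refl _). Qed.

Lemma rle_meet a b c : a ≼ b -> a ≼ c -> a ≼ (b ⊓ c).
Proof. by rewrite /rle => ab ac; rewrite (rmeetA ax) ab ac. Qed.

Lemma rle_join_eq a b : a ≼ b <-> a ⊔ b = b.
Proof.
rewrite /rle; split=> [<-|<-]; last exact: (rjoinKI ax).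
by rewrite (rjoinC ax) (rmeetC ax a) (rmeetKU ax).
Qed.

Lemma rle_joinl a b : a ≼ (a ⊔ b).
Proof. exact: (rjoinKI ax). Qed.

Lemma rle_joinr a b : b ≼ (a ⊔ b).
Proof. by rewrite (rjoinC ax); exact: rle_joinl. Qed.

Lemma rle_join a b c : a ≼ c -> b ≼ c -> (a ⊔ b) ≼ c.
Proof.
move=> /rle_join_eq ac /rle_join_eq bc; apply/rle_join_eq.
by rewrite -(rjoinA ax) bc ac.
Qed.

Lemma rlex1 a : a ≼ rtop.
Proof. by rewrite /rle (rmeetC ax) (rmeet1x ax). Qed.

Lemma rle1 a : rtop ≼ a -> a = rtop.
Proof. by move=> h; apply: rle_anti h; exact: rlex1. Qed.

Lemma rmulx1 a : a ⊙ rtop = a.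
Proof. by rewrite (rmulC ax) (rmul1x ax). Qed.

Lemma rle_mul2r c a b : a ≼ b -> (a ⊙ c) ≼ (b ⊙ c).
Proof.
move=> ab; apply/(rresid ax); apply: (rle_trans ab).
by apply/(rresid ax); exact: rle_refl.
Qed.

Lemma rle_mul a b c d : a ≼ b -> c ≼ d -> (a ⊙ c) ≼ (b ⊙ d).
Proof.
move=> ab cd; apply: rle_trans (rle_mul2r c ab) _.
by rewrite (rmulC ax b) (rmulC ax b); exact: rle_mul2r.
Qed.

Lemma rmul_lel a b : (a ⊙ b) ≼ a.
Proof.
by rewrite -[X in _ ≼ X]rmulx1; apply: rle_mul; [exact: rle_refl|exact: rlex1].
Qed.

Lemma rmul_ler a b : (a ⊙ b) ≼ b.
Proof. by rewrite (rmulC ax); exact: rmul_lel. Qed.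

Lemma rimp_mp a b : ((a ⇒ b) ⊙ a) ≼ b.
Proof. by apply/(rresid ax); exact: rle_refl. Qed.

Lemma rimp1 a b : a ≼ b -> a ⇒ b = rtop.
Proof. by move=> ab; apply/rle1/(rresid ax); rewrite (rmul1x ax). Qed.

Lemma rle_of_imp1 a b : a ⇒ b = rtop -> a ≼ b.
Proof. by move=> h; have := rimp_mp a b; rewrite h (rmul1x ax). Qed.

Lemma rdistC a b : rdist a b = rdist b a.
Proof. exact: (rmeetC ax). Qed.

Lemma rdistxx a : rdist a a = rtop.
Proof. by rewrite /rdist (rimp1 (rle_refl a)) rle_refl. Qed.

Lemma rdist_eq a b : rdist a b = rtop -> a = b.
Proof.
move=> h; apply: rle_anti; apply: rle_of_imp1; apply: rle1; rewrite -h.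
- exact: rle_meetl.
- exact: rle_meetr.
Qed.

Lemma rle_distE t a b : (t ⊙ a) ≼ b -> (t ⊙ b) ≼ a -> t ≼ rdist a b.
Proof. by move=> ab ba; apply: rle_meet; apply/(rresid ax). Qed.

Lemma rdist_mpl a b : (rdist a b ⊙ a) ≼ b.
Proof. by apply/(rresid ax); exact: rle_meetl. Qed.

Lemma rdist_mpr a b : (rdist a b ⊙ b) ≼ a.
Proof. by apply/(rresid ax); exact: rle_meetr. Qed.

Lemma rdist_trans a b c : (rdist a b ⊙ rdist b c) ≼ rdist a c.
Proof.
apply: rle_distE.
  rewrite (rmulC ax (rdist a b)) -(rmulA ax).
  apply: rle_trans (rdist_mpl b c).
  by apply: rle_mul; [exact: rle_refl|exact: rdist_mpl].
rewrite -(rmulA ax); apply: rle_trans (rdist_mpr a b).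
by apply: rle_mul; [exact: rle_refl|exact: rdist_mpr].
Qed.

Lemma rdist_op (op : A -> A -> A) :
  (forall t u a a' b b' : A,
     (t ⊙ a) ≼ a' -> (t ⊙ a') ≼ a -> (u ⊙ b) ≼ b' -> (u ⊙ b') ≼ b ->
     ((t ⊙ u) ⊙ op a b) ≼ op a' b') ->
  forall a a' b b',
    (rdist a a' ⊙ rdist b b') ≼ rdist (op a b) (op a' b').
Proof.
move=> H a a' b b'; apply: rle_distE; apply: H;
  by [exact: rdist_mpl|exact: rdist_mpr].
Qed.

Lemma rdist_join a a' b b' :
  (rdist a a' ⊙ rdist b b') ≼ rdist (a ⊔ b) (a' ⊔ b').
Proof.
apply: (rdist_op (op := @rjoin A)) => {a a' b b'} t u a a' b b' ta _ ub _.
rewrite (rmulC ax); apply/(rresid ax); apply: rle_join; apply/(rresid ax).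
- apply: rle_trans (rle_joinl a' b'); apply: rle_trans ta.
  rewrite (rmulC ax t a); apply: rle_mul; first exact: rle_refl.
  exact: rmul_lel.
- apply: rle_trans (rle_joinr a' b'); apply: rle_trans ub.
  rewrite (rmulC ax u b); apply: rle_mul; first exact: rle_refl.
  exact: rmul_ler.
Qed.

Lemma rdist_meet a a' b b' :
  (rdist a a' ⊙ rdist b b') ≼ rdist (a ⊓ b) (a' ⊓ b').
Proof.
apply: (rdist_op (op := @rmeet A)) => {a a' b b'} t u a a' b b' ta _ ub _.
apply: rle_meet.
- apply: rle_trans ta; apply: rle_mul; [exact: rmul_lel|exact: rle_meetl].
- apply: rle_trans ub; apply: rle_mul; [exact: rmul_ler|exact: rle_meetr].
Qed.

Lemma rmulACA a b c d : (a ⊙ b) ⊙ (c ⊙ d) = (a ⊙ c) ⊙ (b ⊙ d).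
Proof.
by rewrite -!(rmulA ax) (rmulA ax b) (rmulC ax b c) -(rmulA ax c b d).
Qed.

Lemma rdist_mul a a' b b' :
  (rdist a a' ⊙ rdist b b') ≼ rdist (a ⊙ b) (a' ⊙ b').
Proof.
apply: (rdist_op (op := @rmul A)) => {a a' b b'} t u a a' b b' ta _ ub _.
by rewrite rmulACA; exact: rle_mul.
Qed.

Lemma rdist_imp a a' b b' :
  (rdist a a' ⊙ rdist b b') ≼ rdist (a ⇒ b) (a' ⇒ b').
Proof.
apply: (rdist_op (op := @rimp A)) => {a a' b b'} t u a a' b b' _ ta ub _.
apply/(rresid ax); apply: rle_trans ub.
rewrite (rmulC ax t u) -!(rmulA ax); apply: rle_mul; first exact: rle_refl.
rewrite (rmulC ax _ a') (rmulA ax) (rmulC ax).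
apply: rle_trans (rimp_mp a b).
by apply: rle_mul; [exact: rle_refl|].
Qed.

Lemma increases_to_top_mul (c e : nat -> A) :
  increases_to_top c -> increases_to_top e ->
  increases_to_top (fun n => c n ⊙ e n).
Proof.
move=> [cinc [_ csup]] [einc [_ esup]]; split.
  by move=> m n mn; apply: rle_mul; [exact: cinc|exact: einc].
split=> [n|y ub]; first exact: rlex1.
rewrite -(rmul1x ax rtop); apply/(rresid ax); apply: csup => n.
apply/(rresid ax); rewrite (rmulC ax); apply/(rresid ax); apply: esup => m.
apply/(rresid ax); rewrite (rmulC ax).
apply: rle_trans (ub (maxn n m)).
by apply: rle_mul; [apply: cinc; exact: leq_maxl|apply: einc; exact: leq_maxr].
Qed.

Lemma increases_to_top_cst : increases_to_top (fun=> rtop : A).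
Proof.
split=> [m n _|]; first exact: rlex1.
by split=> [n|y /(_ 0)] //; exact: rlex1.
Qed.

Lemma converges_unique (u : nat -> A) l l' :
  converges u l -> converges u l' -> l = l'.
Proof.
move=> [c ci cl] [e ei el]; apply: rdist_eq.
have [_ [_ sup]] := increases_to_top_mul ci ei.
apply: rle1; apply: sup => n; apply: rle_trans (rdist_trans l (u n) l').
by apply: rle_mul => //; rewrite rdistC.
Qed.

Lemma rlimE (u : nat -> A) l : converges u l -> rlim u = l.
Proof.
move=> ul; apply: (@xget_unique {classic A}) => // l' ul'.
exact: converges_unique ul' ul.
Qed.

Lemma rdistx1 a : rdist a rtop = a.
Proof.
rewrite /rdist (rimp1 (rlex1 a)) (rmeet1x ax); apply: rle_anti.
  by have := rimp_mp rtop a; rewrite rmulx1.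
by apply/(rresid ax); rewrite rmulx1; exact: rle_refl.
Qed.

Lemma converges1 (u : nat -> A) :
  converges u rtop <->
  exists2 c : nat -> A, increases_to_top c & forall n, c n ≼ u n.
Proof. by split=> -[c ci cu]; exists c => // n; move: (cu n); rewrite rdistx1. Qed.

End ResiduatedLatticeTheory.

Section StateTheory.
Variables (A L : residuatedLattice) (s : A -> L).
Hypotheses (hs : typeI_state s) (ho : order_preserving s).

Let axA := rl_axioms A.
Let axL := rl_axioms L.

Lemma state_mul a b : (s a ⊙ s b) ≼ s (a ⊙ b).
Proof.
have [_ _ himp] := hs.
rewrite (rmulC axL); apply/(rresid axL).
rewrite -himp; last exact: rmul_lel.
by apply: ho; apply/(rresid axA); rewrite (rmulC axA); exact: rle_refl.
Qed.

Lemma state_dist a b : rho s a b ≼ rdist (s a) (s b).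
Proof.
apply: rle_distE; apply: rle_trans (state_mul _ _) _; apply: ho.
- exact: rdist_mpl.
- exact: rdist_mpr.
Qed.

Lemma rho_similarity : similarity (rho s).
Proof.
have [_ s1 _] := hs; split.
- by move=> a; rewrite /rho rdistxx.
- by move=> a b; rewrite /rho rdistC.
- move=> a b c; apply: rle_trans (state_mul _ _) _; apply: ho.
  exact: rdist_trans.
Qed.

Lemma rhoxx a : rho s a a = rtop.
Proof. by case: rho_similarity. Qed.

Lemma rhoC a b : rho s a b = rho s b a.
Proof. by case: rho_similarity. Qed.

Lemma rho_trans b a c : (rho s a b ⊙ rho s b c) ≼ rho s a c.
Proof. by case: rho_similarity. Qed.

Lemma rho_dist a a' b b' :
  (rho s a a' ⊙ rho s b b') ≼ rdist (rho s a b) (rho s a' b').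
Proof.
apply: rle_distE.
- rewrite (rmulC axL) (rmulA axL) (rmulC axL _ (rho s a a')).
  apply: rle_trans (rho_trans b a' b').
  apply: rle_mul; last exact: rle_refl.
  by rewrite rhoC; exact: rho_trans.
- rewrite -(rmulA axL) (rmulC axL (rho s b b')) (rhoC b).
  apply: rle_trans (rho_trans a' a b).
  by apply: rle_mul; [exact: rle_refl|exact: rho_trans].
Qed.

Definition nonexpansive (op : A -> A -> A) : Prop :=
  forall a a' b b', (rho s a a' ⊙ rho s b b') ≼ rho s (op a b) (op a' b').

Lemma nonexpansive_dist (op : A -> A -> A) :
  (forall a a' b b', (rdist a a' ⊙ rdist b b') ≼ rdist (op a b) (op a' b')) ->
  nonexpansive op.
Proof.
by move=> h a a' b b'; apply: rle_trans (state_mul _ _) _; apply: ho.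
Qed.

Lemma rho_cauchy_op (op : A -> A -> A) (u v : nat -> A) :
  nonexpansive op -> E_cauchy (rho s) u -> E_cauchy (rho s) v ->
  E_cauchy (rho s) (fun n => op (u n) (v n)).
Proof.
move=> hop [c ci cu] [e ei ev].
exists (fun n => c n ⊙ e n); first exact: increases_to_top_mul.
by move=> n p; apply: rle_trans (hop _ _ _ _); apply: rle_mul.
Qed.

Lemma rho_cauchy_cst a : E_cauchy (rho s) (fun=> a).
Proof.
exists (fun=> rtop); first exact: increases_to_top_cst.
by move=> n p; rewrite rhoxx; exact: rle_refl.
Qed.

Definition cauchy_seq : Type := {u : nat -> A | E_cauchy (rho s) u}.

Definition cseq_op (op : A -> A -> A) (hop : nonexpansive op)
    (u v : cauchy_seq) : cauchy_seq :=
  exist _ (fun n => op (sval u n) (sval v n))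
    (rho_cauchy_op hop (svalP u) (svalP v)).

Definition cseq_join :=
  cseq_op (nonexpansive_dist (@rdist_join A)).
Definition cseq_meet :=
  cseq_op (nonexpansive_dist (@rdist_meet A)).
Definition cseq_mul :=
  cseq_op (nonexpansive_dist (@rdist_mul A)).
Definition cseq_imp :=
  cseq_op (nonexpansive_dist (@rdist_imp A)).

Definition cseq_cst (a : A) : cauchy_seq := exist _ (fun=> a) (rho_cauchy_cst a).

Definition cseq_sim (u v : {classic cauchy_seq}) : bool :=
  `[< converges (fun n => rho s (sval u n) (sval v n)) rtop >].

Lemma cseq_sim_refl : reflexive cseq_sim.
Proof.
move=> u; apply/asboolP/converges1; exists (fun=> rtop).
  exact: increases_to_top_cst.
by move=> n; rewrite rhoxx; exact: rle_refl.
Qed.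

Lemma cseq_sim_sym : symmetric cseq_sim.
Proof.
suff h u v : cseq_sim u v -> cseq_sim v u by move=> u v; apply/idP/idP; exact: h.
move=> /asboolP/converges1[c ci cu]; apply/asboolP/converges1; exists c => // n.
by rewrite rhoC.
Qed.

Lemma cseq_sim_trans : transitive cseq_sim.
Proof.
move=> v u w /asboolP/converges1[c ci cu] /asboolP/converges1[e ei ev].
apply/asboolP/converges1; exists (fun n => c n ⊙ e n).
  exact: increases_to_top_mul.
move=> n; apply: rle_trans (rho_trans (sval v n) (sval u n) (sval w n)).
by apply: rle_mul.
Qed.

Canonical cseq_sim_equiv :=
  EquivRel cseq_sim cseq_sim_refl cseq_sim_sym cseq_sim_trans.

Definition completion_car : Type := {eq_quot cseq_sim_equiv}.

Definition completion : rl_algebra := {|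
  carrier := completion_car;
  rjoin := lift_op2 {eq_quot cseq_sim_equiv} cseq_join;
  rmeet := lift_op2 {eq_quot cseq_sim_equiv} cseq_meet;
  rmul := lift_op2 {eq_quot cseq_sim_equiv} cseq_mul;
  rimp := lift_op2 {eq_quot cseq_sim_equiv} cseq_imp;
  rbot := \pi_{eq_quot cseq_sim_equiv} (cseq_cst rbot);
  rtop := \pi_{eq_quot cseq_sim_equiv} (cseq_cst rtop)
|}.

Definition cclass (u : cauchy_seq) : completion :=
  \pi_{eq_quot cseq_sim_equiv} u.

Definition completion_state : completion -> L :=
  lift_fun1 {eq_quot cseq_sim_equiv} (fun u => rlim (fun n => s (sval u n))).

Definition completion_rho : completion -> completion -> L :=
  lift_fun2 {eq_quot cseq_sim_equiv}
    (fun u v => rlim (fun n => rho s (sval u n) (sval v n))).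

Definition completion_emb (a : A) : completion := cclass (cseq_cst a).

(* The operations, [completion_state] and [completion_rho] are computed on
   chosen representatives; the lemmas below say that the choice is irrelevant
   and, when [L] is Cauchy-complete, that the limits exist. *)

Lemma cclass_eq (u v : cauchy_seq) :
  cclass u = cclass v <->
  converges (fun n => rho s (sval u n) (sval v n)) rtop.
Proof.
by split=> [/eqmodP/asboolP|h] //; apply/eqmodP/asboolP.
Qed.

Lemma cclass_repr (x : completion) : exists u, x = cclass u.
Proof. by exists (repr (x : {eq_quot cseq_sim_equiv})); rewrite /cclass reprK. Qed.

Lemma cseq_op_compat op (hop : nonexpansive op) (u u' v v' : cauchy_seq) :
  cclass u = cclass u' -> cclass v = cclass v' ->
  cclass (cseq_op hop u v) = cclass (cseq_op hop u' v').
Proof.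
move=> /cclass_eq/converges1[c ci cu] /cclass_eq/converges1[e ei ev].
apply/cclass_eq/converges1; exists (fun n => c n ⊙ e n).
  exact: increases_to_top_mul.
by move=> n; apply: rle_trans (hop _ _ _ _); apply: rle_mul.
Qed.

Lemma cclass_join u v : cclass u ⊔ cclass v = cclass (cseq_join u v).
Proof. by rewrite /= -lock; apply: cseq_op_compat; rewrite /cclass reprK. Qed.

Lemma cclass_meet u v : cclass u ⊓ cclass v = cclass (cseq_meet u v).
Proof. by rewrite /= -lock; apply: cseq_op_compat; rewrite /cclass reprK. Qed.

Lemma cclass_mul u v : cclass u ⊙ cclass v = cclass (cseq_mul u v).
Proof. by rewrite /= -lock; apply: cseq_op_compat; rewrite /cclass reprK. Qed.

Lemma cclass_imp u v : cclass u ⇒ cclass v = cclass (cseq_imp u v).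
Proof. by rewrite /= -lock; apply: cseq_op_compat; rewrite /cclass reprK. Qed.

Lemma converges_shift (u v : nat -> L) l :
  converges (fun n => rdist (u n) (v n)) rtop -> converges u l ->
  converges v l.
Proof.
move=> /converges1[c ci cu] [e ei eu]; exists (fun n => c n ⊙ e n).
  exact: increases_to_top_mul.
move=> n; apply: rle_trans (rdist_trans (v n) (u n) l).
by apply: rle_mul => //; rewrite rdistC.
Qed.

Hypothesis Lc : cauchy_complete L.

Lemma completion_stateP (u : cauchy_seq) :
  converges (fun n => s (sval u n)) (completion_state (cclass u)).
Proof.
have ex (v : cauchy_seq) : exists l, converges (fun n => s (sval v n)) l.
  case: v => v /= [c ci cv]; apply: Lc; exists c => // n p.
  by apply: rle_trans (state_dist _ _).
rewrite /completion_state -lock; set v := repr _.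
have [l vl] := ex v; rewrite (rlimE vl).
apply: converges_shift vl.
have /cclass_eq/converges1[c ci cv] : cclass v = cclass u by rewrite /cclass reprK.
apply/converges1; exists c => // n.
by apply: rle_trans (state_dist _ _).
Qed.

Lemma completion_rhoP (u v : cauchy_seq) :
  converges (fun n => rho s (sval u n) (sval v n))
    (completion_rho (cclass u) (cclass v)).
Proof.
have ex (u' v' : cauchy_seq) : exists l, converges (fun n => rho s (sval u' n) (sval v' n)) l.
  case: u' v' => [u' [c ci cu']] [v' [e ei ev']] /=; apply: Lc.
  exists (fun n => c n ⊙ e n); first exact: increases_to_top_mul.
  by move=> n p; apply: rle_trans (rho_dist _ _ _ _); apply: rle_mul.
rewrite /completion_rho -lock; set u' := repr _; set v' := repr _.
have [l hl] := ex u' v'; rewrite (rlimE hl).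
apply: converges_shift hl.
have /cclass_eq/converges1[c ci cu] : cclass u' = cclass u by rewrite /cclass reprK.
have /cclass_eq/converges1[e ei ev] : cclass v' = cclass v by rewrite /cclass reprK.
apply/converges1; exists (fun n => c n ⊙ e n).
  exact: increases_to_top_mul.
by move=> n; apply: rle_trans (rho_dist _ _ _ _); apply: rle_mul.
Qed.

End StateTheory.

Arguments completion_state {A L s} hs ho x.
Arguments completion_rho {A L s} hs ho x y.
Arguments completion_emb {A L s} hs ho a.

(* Main.v *)
(* On the completion, [x ≼ y] holds iff [s (u n ⇒ v n)] tends to [1] for some
   (equivalently, all) representatives [u], [v], because
   [rdist (a ⊓ b) a = a ⇒ b]; residuation thus reduces to
   [a ⇒ (b ⇒ c) = (a ⊙ b) ⇒ c] in [A]. All operations of a residuated lattice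
   are nonexpansive for [rdist], hence commute with limits, which transfers the
   state axioms to the limit state. For the universal property, [m ∘ f = s]
   makes [f] an isometry from [rho s] to [rho m], so it extends by sending the
   class of [u] to the [rho m]-limit of [f ∘ u]. *)

Require Import Defs.
From mathcomp Require Import ssreflect ssrfun ssrbool.
From mathcomp Require Import boolp.

Set Implicit Arguments.
Unset Strict Implicit.
Unset Printing Implicit Defensive.

Local Open Scope rl_scope.

(** * Residuation identities and limits in a residuated lattice *)

Section ResiduatedLatticeFacts.
Variable A : residuatedLattice.
Implicit Types a b c : A.

Let ax := rl_axioms A.

Lemma rle0x a : rbot ≼ a.
Proof. by apply/rle_join_eq; exact: (rjoin0x ax). Qed.

(** Antisymmetry in Yoneda form: an identity between residuals can be proved by rewriting with the
    adjunction below an arbitrary [c]. *)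
Lemma rle_le_eq a b : (forall c, c ≼ a <-> c ≼ b) -> a = b.
Proof.
by move=> h; apply: rle_anti; [apply/h|apply/(h b)]; exact: rle_refl.
Qed.

Lemma rimpA a b c : a ⇒ (b ⇒ c) = (a ⊙ b) ⇒ c.
Proof.
by apply: rle_le_eq => d; rewrite !(rresid ax) (rmulA ax).
Qed.

(** One of the two implications is [rtop]. For the other, [c ⊙ a ≼ a] always holds, so
    [c ⊙ a ≼ a ⊓ b] amounts to [c ⊙ a ≼ b]. *)
Lemma rdist_meetl a b : rdist (a ⊓ b) a = a ⇒ b.
Proof.
rewrite /rdist (rimp1 (rle_meetl a b)) (rmeet1x ax).
apply: rle_le_eq => c; rewrite !(rresid ax); split=> [h|h].
  exact: rle_trans h (rle_meetr a b).
by apply: rle_meet => //; exact: rmul_ler.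
Qed.

Lemma rneg_negr a : a ≼ rneg (rneg a).
Proof.
apply/(rresid ax); rewrite (rmulC ax); exact: rimp_mp.
Qed.

Lemma converges_cst a : converges (fun=> a) a.
Proof.
exists (fun=> rtop); first exact: increases_to_top_cst.
by move=> n; rewrite rdistxx; exact: rle_refl.
Qed.

Lemma converges_op2 (op : A -> A -> A) (u v : nat -> A) l k :
  (forall a a' b b', (rdist a a' ⊙ rdist b b') ≼ rdist (op a b) (op a' b')) ->
  converges u l -> converges v k -> converges (fun n => op (u n) (v n)) (op l k).
Proof.
move=> hop [c ci cu] [e ei ev]; exists (fun n => c n ⊙ e n).
  exact: increases_to_top_mul.
by move=> n; apply: rle_trans (hop _ _ _ _); exact: rle_mul.
Qed.

(** By continuity of the meet, [u n ⊓ v n = u n] tends to both [l ⊓ k] and [l]. *)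
Lemma converges_le (u v : nat -> A) l k :
  (forall n, u n ≼ v n) -> converges u l -> converges v k -> l ≼ k.
Proof.
move=> uv ul vk; rewrite /rle.
apply: converges_unique (converges_op2 (@rdist_meet A) ul vk) _.
by have -> : (fun n => u n ⊓ v n) = u by apply: funext.
Qed.

End ResiduatedLatticeFacts.

(** * Convergence with respect to the distance of a state *)

Section StateConvergence.
Variables (A L : residuatedLattice) (s : A -> L).
Hypotheses (hs : typeI_state s) (ho : order_preserving s).

Lemma E_converges_op2 (op : A -> A -> A) (u v : nat -> A) a b :
  (forall a a' b b', (rdist a a' ⊙ rdist b b') ≼ rdist (op a b) (op a' b')) ->
  E_converges (rho s) u a -> E_converges (rho s) v b ->
  E_converges (rho s) (fun n => op (u n) (v n)) (op a b).
Proof.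
move=> hop /converges1[c ci cu] /converges1[e ei ev].
apply/converges1; exists (fun n => c n ⊙ e n); first exact: increases_to_top_mul.
move=> n; apply: rle_trans (nonexpansive_dist hs ho hop _ _ _ _).
exact: rle_mul.
Qed.

Lemma E_converges_cst a : E_converges (rho s) (fun=> a) a.
Proof. by rewrite /E_converges (rhoxx hs ho); exact: converges_cst. Qed.

(** A state is nonexpansive from [rho s] to [rdist], so the same lower bounds [c] serve. *)
Lemma state_converges (u : nat -> A) a :
  E_converges (rho s) u a -> converges (fun n => s (u n)) (s a).
Proof.
move=> /converges1[c ci cu]; exists c => // n.
exact: rle_trans (cu n) (state_dist hs ho _ _).
Qed.

Lemma faithful_L_equality : faithful s -> L_equality (rho s).
Proof.
by move=> hf; split; [exact: rho_similarity|move=> a b /hf; exact: rdist_eq].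
Qed.

Lemma E_converges_sim (u v : nat -> A) a :
  converges (fun n => rho s (u n) (v n)) rtop ->
  E_converges (rho s) u a -> E_converges (rho s) v a.
Proof.
move=> /converges1[c ci cu] /converges1[e ei ev].
apply/converges1; exists (fun n => c n ⊙ e n); first exact: increases_to_top_mul.
move=> n; apply: rle_trans (rho_trans hs ho (u n) _ _).
by apply: rle_mul => //; rewrite rhoC.
Qed.

Lemma E_converges_unique (u : nat -> A) a b : faithful s ->
  E_converges (rho s) u a -> E_converges (rho s) u b -> a = b.
Proof.
move=> /faithful_L_equality[_ rho_eq] ua ub; apply: rho_eq; rewrite rhoC //.
(* Read as a similarity of [u] to the constant sequence [b], [ub] moves the limit [a] of [u] to that
   constant sequence; hence the constant [rho s b a] tends to [rtop]. *)
exact: converges_unique (converges_cst _) (E_converges_sim ub ua).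
Qed.

(** Since [rbot ≼ b], the type I axiom makes [s] commute with negation. Thus [s] takes the same
    value at [a] and at its double negation, and the axiom applies once more because [a] lies below
    the latter. *)
Lemma state_negneg a : rl_involutive L -> s (rneg (rneg a) ⇒ a) = rtop.
Proof.
have [s0 _ simp] := hs => Linv.
have sneg b : s (rneg b) = rneg (s b) by rewrite /rneg simp ?s0 //; exact: rle0x.
by rewrite simp ?sneg ?Linv; [apply: rimp1; exact: rle_refl|exact: rneg_negr].
Qed.

End StateConvergence.

(** * Algebraic structure of the completion and the embedding *)

Section Completion.
Variables (A L : residuatedLattice) (s : A -> L).
Hypotheses (hs : typeI_state s) (ho : order_preserving s).

Let axA := rl_axioms A.
Local Notation At := (completion hs ho).
Local Notation cl := (cclass hs ho).

(** Transfers the identities of [A] to the completion term by term. *)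
Lemma cclass_ext (u v : cauchy_seq s) : sval u =1 sval v -> cl u = cl v.
Proof.
move=> uv; apply/cclass_eq/converges1; exists (fun=> rtop).
  exact: increases_to_top_cst.
by move=> n; rewrite uv rhoxx //; exact: rle_refl.
Qed.

Lemma cclass_leP (u v : cauchy_seq s) :
  cl u ≼ cl v <-> converges (fun n => s (sval u n ⇒ sval v n)) rtop.
Proof.
rewrite /rle cclass_meet cclass_eq /=.
suff -> : (fun n => rho s (sval u n ⊓ sval v n) (sval u n)) =
          (fun n => s (sval u n ⇒ sval v n)) by [].
by apply: funext => n; rewrite /rho rdist_meetl.
Qed.

(** The termwise meet [v ⊓ u] is another representative of the smaller class. It provides the
    termwise inequalities that the type I axiom and monotonicity of [s] require. *)
Lemma cclass_le (u v : cauchy_seq s) :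
  cl v ≼ cl u -> exists2 w, cl v = cl w & forall n, sval w n ≼ sval u n.
Proof.
rewrite /rle cclass_meet => <-; exists (cseq_meet hs ho v u) => // n.
exact: rle_meetr.
Qed.

Lemma completion_residuated : is_residuated_lattice At.
Proof.
have E := (cclass_join, cclass_meet, cclass_mul).
split.
- move=> x y z; have [u ->] := cclass_repr x; have [v ->] := cclass_repr y.
  have [w ->] := cclass_repr z; rewrite !E; apply: cclass_ext => n.
  exact: (rjoinA axA).
- move=> x y; have [u ->] := cclass_repr x; have [v ->] := cclass_repr y.
  by rewrite !E; apply: cclass_ext => n; exact: (rjoinC axA).
- move=> x y z; have [u ->] := cclass_repr x; have [v ->] := cclass_repr y.
  have [w ->] := cclass_repr z; rewrite !E; apply: cclass_ext => n.
  exact: (rmeetA axA).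
- move=> x y; have [u ->] := cclass_repr x; have [v ->] := cclass_repr y.
  by rewrite !E; apply: cclass_ext => n; exact: (rmeetC axA).
- move=> x y; have [u ->] := cclass_repr x; have [v ->] := cclass_repr y.
  by rewrite !E; apply: cclass_ext => n; exact: (rmeetKU axA).
- move=> x y; have [u ->] := cclass_repr x; have [v ->] := cclass_repr y.
  by rewrite !E; apply: cclass_ext => n; exact: (rjoinKI axA).
- move=> x; have [u ->] := cclass_repr x.
  (* The bottom of the completion is by definition the class of a constant sequence, so this join is
     also computed termwise. *)
  rewrite [LHS](cclass_join hs ho (cseq_cst hs ho rbot)).
  by apply: cclass_ext => n; exact: (rjoin0x axA).
- move=> x; have [u ->] := cclass_repr x.
  rewrite [LHS](cclass_meet hs ho (cseq_cst hs ho rtop)).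
  by apply: cclass_ext => n; exact: (rmeet1x axA).
- move=> x y z; have [u ->] := cclass_repr x; have [v ->] := cclass_repr y.
  have [w ->] := cclass_repr z; rewrite !E; apply: cclass_ext => n.
  exact: (rmulA axA).
- move=> x y; have [u ->] := cclass_repr x; have [v ->] := cclass_repr y.
  by rewrite !E; apply: cclass_ext => n; exact: (rmulC axA).
- move=> x; have [u ->] := cclass_repr x.
  rewrite [LHS](cclass_mul hs ho (cseq_cst hs ho rtop)).
  by apply: cclass_ext => n; exact: (rmul1x axA).
- move=> x y z; have [u ->] := cclass_repr x; have [v ->] := cclass_repr y.
  have [w ->] := cclass_repr z.
  rewrite cclass_imp cclass_mul !cclass_leP /=.
  suff -> : (fun n => s (sval u n ⇒ (sval v n ⇒ sval w n))) =
            (fun n => s ((sval u n ⊙ sval v n) ⇒ sval w n)) by [].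
  by apply: funext => n; rewrite rimpA.
Qed.

Lemma completion_involutive : rl_involutive L -> rl_involutive At.
Proof.
move=> Linv x; have [u ->] := cclass_repr x.
have neg (v : cauchy_seq s) :
  rneg (cl v) = cl (cseq_imp hs ho v (cseq_cst hs ho rbot)) by exact: cclass_imp.
rewrite !neg; apply/cclass_eq.
rewrite (_ : (fun n => _) = fun=> rtop); first exact: converges_cst.
(* One implication is [rtop] in [A] itself; the other is sent to [rtop] by [s], as [L] is
   involutive. *)
apply: funext => n; rewrite /= /rho /rdist (rimp1 (rneg_negr (sval u n))).
by rewrite (rmeetC axA) (rmeet1x axA) (state_negneg hs).
Qed.

Lemma completion_emb_morphism : rl_morphism (completion_emb hs ho : A -> At).
Proof.
split=> [a b|a b|a b|a b|//]; rewrite /completion_emb.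
- by rewrite cclass_join; exact: cclass_ext.
- by rewrite cclass_meet; exact: cclass_ext.
- by rewrite cclass_mul; exact: cclass_ext.
- by rewrite cclass_imp; exact: cclass_ext.
Qed.

Lemma completion_emb_eq a b :
  completion_emb hs ho a = completion_emb hs ho b <-> rho s a b = rtop.
Proof.
rewrite cclass_eq /=; split=> h; last by rewrite h; exact: converges_cst.
exact: converges_unique (converges_cst _) h.
Qed.

Lemma completion_emb_inj : injective (completion_emb hs ho) <-> faithful s.
Proof.
split=> [inj a sa|hf a b /completion_emb_eq/hf/rdist_eq //].
(* Injectivity is used on the pair [a], [rtop], whose distance is [s a]. *)
by apply/inj/completion_emb_eq; rewrite /rho rdistx1.
Qed.

(** * The limit state and the limit distance *)

Hypothesis Lc : cauchy_complete L.

Local Notation st := (completion_state hs ho).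
Local Notation rhot := (completion_rho hs ho).
Local Notation phi := (completion_emb hs ho).

Lemma completion_stateE (u : cauchy_seq s) l :
  converges (fun n => s (sval u n)) l -> st (cl u) = l.
Proof. exact/converges_unique/completion_stateP. Qed.

Lemma completion_rhoE (u v : cauchy_seq s) l :
  converges (fun n => rho s (sval u n) (sval v n)) l -> rhot (cl u) (cl v) = l.
Proof. exact/converges_unique/completion_rhoP. Qed.

Lemma completion_state_emb a : st (phi a) = s a.
Proof. by apply: completion_stateE => /=; exact: converges_cst. Qed.

Lemma completion_rho_emb a b : rhot (phi a) (phi b) = rho s a b.
Proof. by apply: completion_rhoE => /=; exact: converges_cst. Qed.

(** The distance of two classes is represented by the termwise distances, so both sides are the
    limit of the same sequence in [L]. *)
Lemma completion_rho_state x y : rhot x y = rho st x y.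
Proof.
have [u ->] := cclass_repr x; have [v ->] := cclass_repr y.
rewrite /rho /rdist !cclass_imp cclass_meet; apply: completion_rhoE.
by have := completion_stateP hs ho Lc
  (cseq_meet hs ho (cseq_imp hs ho u v) (cseq_imp hs ho v u)).
Qed.

Lemma completion_state_typeI : typeI_state st.
Proof.
have [s0 s1 simp] := hs; split.
- by rewrite -[RHS]s0 -completion_state_emb.
- by rewrite -[RHS]s1 -completion_state_emb.
move=> x y; have [u ->] := cclass_repr x; have [v ->] := cclass_repr y.
move=> /cclass_le[w -> wu]; rewrite cclass_imp; apply: completion_stateE.
rewrite (_ : (fun n => _) = fun n => s (sval u n) ⇒ s (sval w n)).
  by apply: converges_op2 (@rdist_imp L) _ _; exact: completion_stateP.
by apply: funext => n /=; rewrite simp.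
Qed.

Lemma completion_state_order : order_preserving st.
Proof.
move=> x y; have [v ->] := cclass_repr x; have [u ->] := cclass_repr y.
move=> /cclass_le[w -> wu].
apply: (@converges_le L (fun n => s (sval w n)) (fun n => s (sval u n))).
- by move=> n; exact: ho.
- exact: completion_stateP.
- exact: completion_stateP.
Qed.

(** Because [rho s a rtop = s a], the sequence [s (u n)] tends to [rtop] exactly when [u] is similar
    to the constant sequence [rtop]. *)
Lemma completion_state_faithful : faithful st.
Proof.
move=> x; have [u ->] := cclass_repr x => su.
apply: (iffRL (cclass_eq hs ho u (cseq_cst hs ho rtop))) => /=.
rewrite (_ : (fun n => _) = fun n => s (sval u n)).
  by rewrite -su; exact: completion_stateP.
by apply: funext => n; rewrite /rho rdistx1.
Qed.

(** * Universal property: extension of morphisms to the completion *)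

Section Extension.
Variables (C : residuatedLattice) (m : C -> L) (f : A -> C).
Hypotheses (hm : typeI_state m) (hom : order_preserving m) (mf : faithful m).
Hypothesis Cc : E_complete (rho m).
Hypotheses (fM : rl_morphism f) (mfs : forall a, m (f a) = s a).

Lemma morphism_isometry a b : rho m (f a) (f b) = rho s a b.
Proof.
by have [_ fI _ fR _] := fM; rewrite /rho /rdist -mfs fI !fR.
Qed.

(** Quantifying over all representatives makes the limit depend on the class alone, so that [choice]
    yields a map on the completion. *)
Lemma completion_extension_limit (x : At) :
  exists c, forall u, x = cl u -> E_converges (rho m) (fun n => f (sval u n)) c.
Proof.
have [u ->] := cclass_repr x.
have [|c uc] := Cc.2 (fun n => f (sval u n)).
  have [c ci cu] := svalP u; exists c => // n p.
  by rewrite morphism_isometry.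
exists c => v /cclass_eq uv; apply: E_converges_sim uc => //.
rewrite (_ : (fun n => _) = fun n => rho s (sval u n) (sval v n)) //.
by apply: funext => n; rewrite morphism_isometry.
Qed.

Lemma completion_extension : exists ft : At -> C,
  [/\ rl_morphism ft, forall x, m (ft x) = st x & forall a, ft (phi a) = f a].
Proof.
have [fU fI fX fR [f0 f1]] := fM.
have [ft ftP] := choice completion_extension_limit.
(* Faithfulness of [m] makes limits in [C] unique, so [ft] can be evaluated from any one
   representative. *)
have ftE u c : E_converges (rho m) (fun n => f (sval u n)) c -> ft (cl u) = c.
  by move=> uc; exact: (E_converges_unique hm hom mf (ftP _ u erefl) uc).
have ftphi a : ft (phi a) = f a.
  by apply: ftE => /=; exact: E_converges_cst.
(* Preservation of all four operations at once: [f] commutes with them termwise, and they are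
   continuous in [C]. *)
have ft_op (opA : A -> A -> A) (opC : C -> C -> C) (hop : nonexpansive s opA) u v :
    (forall a b, f (opA a b) = opC (f a) (f b)) ->
    (forall a a' b b', (rdist a a' ⊙ rdist b b') ≼ rdist (opC a b) (opC a' b')) ->
    ft (cl (cseq_op hop u v)) = opC (ft (cl u)) (ft (cl v)).
  move=> fop hopC; apply: ftE => /=.
  rewrite (_ : (fun n => _) =
      fun n => opC (f (sval u n)) (f (sval v n))); last exact: funext.
  by apply: E_converges_op2 => //; exact: ftP.
exists ft; split=> //; last first.
  move=> x; have [u ->] := cclass_repr x; apply/esym/completion_stateE.
  (* The sequence [m (f (u n)) = s (u n)] tends to [m (ft x)], which must therefore be the value of
     the limit state. *)
  have := state_converges hm hom (ftP _ u erefl).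
  by rewrite (_ : (fun n => _) = fun n => s (sval u n)) //; exact: funext.
split.
- move=> x y; have [u ->] := cclass_repr x; have [v ->] := cclass_repr y.
  by rewrite cclass_join; exact: (ft_op _ (@rjoin C) _ u v _ (@rdist_join C)).
- move=> x y; have [u ->] := cclass_repr x; have [v ->] := cclass_repr y.
  by rewrite cclass_meet; exact: (ft_op _ (@rmeet C) _ u v _ (@rdist_meet C)).
- move=> x y; have [u ->] := cclass_repr x; have [v ->] := cclass_repr y.
  by rewrite cclass_mul; exact: (ft_op _ (@rmul C) _ u v _ (@rdist_mul C)).
- move=> x y; have [u ->] := cclass_repr x; have [v ->] := cclass_repr y.
  by rewrite cclass_imp; exact: (ft_op _ (@rimp C) _ u v _ (@rdist_imp C)).
(* The constants of the completion are the images under [phi] of those of [A]. *)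
- by rewrite -f0 -f1 -!ftphi.
Qed.

End Extension.
End Completion.

Theorem theorem6p21 (A L : residuatedLattice) (s : A -> L)
    (Lc : cauchy_complete L) (hs : typeI_state s) (ho : order_preserving s) :
  let At := completion hs ho in
  let st : At -> L := completion_state hs ho in
  let rhot : At -> At -> L := completion_rho hs ho in
  let phi : A -> At := completion_emb hs ho in
  (is_residuated_lattice At /\ (rl_involutive L -> rl_involutive At)) /\
  [/\ typeI_state st, order_preserving st & faithful st] /\
  (rl_morphism phi /\ forall a, st (phi a) = s a) /\
  (injective phi <-> faithful s) /\
  (forall x y, rhot x y = rho st x y) /\
  (forall (u : nat -> A) (a : A),
     E_converges (rho s) u a -> E_converges rhot (fun n => phi (u n)) (phi a)) /\
  (forall (C : residuatedLattice) (m : C -> L) (f : A -> C),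
     typeI_state m -> order_preserving m -> faithful m ->
     E_complete (rho m) ->
     rl_morphism f -> (forall a, m (f a) = s a) ->
     exists ft : At -> C,
       [/\ rl_morphism ft, forall x, m (ft x) = st x
         & forall a, ft (phi a) = f a]).
Proof.
move=> At st rhot phi; split.
  by split; [exact: completion_residuated|exact: completion_involutive].
split.
  split; [exact: completion_state_typeI|exact: completion_state_order|].
  exact: completion_state_faithful.
split.
  split; [exact: completion_emb_morphism|exact: completion_state_emb].
split; first exact: completion_emb_inj.
split; first exact: completion_rho_state.
split=> [u a|C m f]; last exact: completion_extension.
(* The embedding is an isometry, so both convergence statements concern the same sequence in [L]. *)
rewrite /E_converges (_ : (fun n => rhot _ _) = fun n => rho s (u n) a) //.
by apply: funext => n; exact: completion_rho_emb.
Qed.
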